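(* Let $\mathcal H_1$ and $\mathcal H_2$ be two irreducible Nevanlinna-Pick spaces on the same set $X$, with reproducing kernels $K_1$ and $K_2$, respectively, which are both normalized at a point $x_0 \in X$. Then the following are equivalent: (i) $\operatorname{Mult}(\mathcal H_1) = \operatorname{Mult}(\mathcal H_2)$ isometrically (same functions on $X$, same multiplier norm). (ii) $\operatorname{Mult}(\mathcal H_1) = \operatorname{Mult}(\mathcal H_2)$ completely isometrically. (iii) $\mathcal H_1 = \mathcal H_2$ isometrically (same functions on $X$, same Hilbert space norm). (iv) $K_1 = K_2$.
   Context: Reproducing kernel Hilbert spaces are separable complex Hilbert spaces of functions on a set. For such a space $\mathcal H$ on $X$ with kernel $K$, $\operatorname{Mult}(\mathcal H)$ is the algebra of all $\varphi : X \to \mathbb C$ with $\varphi f \in \mathcal H$ for all $f \in \mathcal H$, with norm $\|\varphi\|_{\operatorname{Mult}(\mathcal H)} = \|M_\varphi\|$, where $M_\varphi f = \varphi f$. Identifying $\varphi$ with $M_\varphi$, it is a subalgebra of $\mathcal B(\mathcal H)$ and carries the corresponding operator space structure: the norm of a matrix $[\varphi_{ij}] \in M_n(\operatorname{Mult}(\mathcal H))$ is the operator norm of $[M_{\varphi_{ij}}]$ on $\mathcal H^n$. ''Completely isometrically'' means that the identity map preserves the norm on $n \times n$ matrices for all $n$. $\mathcal H$ is irreducible if $K(x,y) \neq 0$ for all $x,y \in X$ and $K(\cdot,x)$, $K(\cdot,y)$ are linearly independent whenever $x \ne y$. $K$ is normalized at $x_0$ if $K(x,x_0)=1$ for all $x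 \in X$. $\mathcal H$ has the $n$-point Nevanlinna-Pick property if, whenever $z_1,\dots,z_n \in X$ and $\lambda_1,\dots,\lambda_n \in \mathbb C$ are such that the matrix $\big((1-\lambda_i \overline{\lambda_j}) K(z_i,z_j)\big)_{i,j=1}^n$ is positive semidefinite, there is $\varphi \in \operatorname{Mult}(\mathcal H)$ with $\|\varphi\|_{\operatorname{Mult}(\mathcal H)} \le 1$ and $\varphi(z_i)=\lambda_i$ for all $i$. $\mathcal H$ is a Nevanlinna-Pick space if this holds for every $n \ge 1$. *)

(* Defs.v *)
From HB Require Import structures.
From mathcomp Require Import all_boot all_order all_algebra sesquilinear spectral.
From mathcomp Require Import complex.
From mathcomp Require Import all_classical all_reals all_analysis.

Set Implicit Arguments.
Unset Strict Implicit.
Unset Printing Implicit Defensive.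

Import Order.TTheory GRing.Theory Num.Theory.
Import numFieldNormedType.Exports.

Local Open Scope classical_set_scope.
Local Open Scope ring_scope.
Local Open Scope complex_scope.
Local Open Scope sesquilinear_scope.

(* A Hilbert space of functions on X is presented as an abstract complex Hilbert
   space together with the injective linear map [ev] sending a vector to the
   function it is.  Since R[i] also carries an R-module structure, it is written
   R[i]^o wherever it is used as a normed space over itself.  The inner product
   is linear in the first argument and conjugate-linear in the second. *)
Record rkhs (R : realType) (X : Type) := RKHS {
  rkhs_space :> completeNormedModType R[i];
  inner : {dot rkhs_space for @Num.conj R[i]};
  ev : rkhs_space -> X -> R[i];
  normE : forall f : rkhs_space, `|f| ^+ 2 = inner f f;
  rkhs_separable : exists D : set rkhs_space, countable D /\ dense D;
  ev_linear : forall x, scalar (fun f => ev f x);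
  ev_inj : injective ev;
  ev_continuous : forall x, continuous (fun f => ev f x : R[i]^o)
}.

Definition functions (R : realType) (X : Type) (H : rkhs R X) : set (X -> R[i]) :=
  range (@ev R X H).

(* The norm of a normed module over R[i] takes values in R[i]. *)
Definition hnorm (R : realType) (X : Type) (H : rkhs R X) (f : H) : R := complex.Re `|f|.

(* The norm of the Hilbert space direct sum H^n. *)
Definition hnorm_sum (R : realType) (X : Type) (H : rkhs R X) (n : nat)
    (f : 'I_n -> H) : R :=
  Num.sqrt (\sum_i hnorm (f i) ^+ 2).

(* K(., y) is the element of H representing the evaluation at y. *)
Definition reproducing_kernel (R : realType) (X : Type) (H : rkhs R X)
    (K : X -> X -> R[i]) : Prop :=
  forall y, exists k : H,
    (forall x, ev k x = K x y) /\ (forall f : H, ev f y = inner H f k).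

Definition irreducible (R : realType) (X : Type) (K : X -> X -> R[i]) : Prop :=
  (forall x y, K x y != 0) /\
  (forall x y, x <> y -> forall a b : R[i],
     (forall z, a * K z x + b * K z y = 0) -> a = 0 /\ b = 0).

Definition normalized (R : realType) (X : Type) (K : X -> X -> R[i]) (x0 : X) : Prop :=
  forall x, K x x0 = 1.

Definition Mult (R : realType) (X : Type) (H : rkhs R X) : set (X -> R[i]) :=
  [set phi | forall f, functions H f -> functions H (fun x => phi x * f x)].

(* The multiplication operator; the default value 0 is only used if phi is not
   a multiplier. *)
Definition mul_op (R : realType) (X : Type) (H : rkhs R X) (phi : X -> R[i])
    (f : H) : H :=
  xget 0 [set g : H | forall x, ev g x = phi x * ev f x].

Definition mul_op_mx (R : realType) (X : Type) (H : rkhs R X) (n : nat)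
    (phi : 'M[X -> R[i]]_n) (f : 'I_n -> H) : 'I_n -> H :=
  fun i => \sum_j mul_op (phi i j) (f j).

(* The operator norm of T with respect to the norm N, possibly +oo. *)
Definition op_norm (R : realType) (V : Type) (N : V -> R) (T : V -> V) : \bar R :=
  ereal_sup [set (N (T f))%:E | f in [set f | N f <= 1]].

Definition mult_norm (R : realType) (X : Type) (H : rkhs R X)
    (phi : X -> R[i]) : \bar R :=
  op_norm (@hnorm R X H) (mul_op phi).

Definition mult_mx_norm (R : realType) (X : Type) (H : rkhs R X) (n : nat)
    (phi : 'M[X -> R[i]]_n) : \bar R :=
  op_norm (@hnorm_sum R X H n) (mul_op_mx phi).

Definition psdmx (R : realType) (n : nat) (A : 'M[R[i]]_n) : Prop :=
  forall v : 'cV[R[i]]_n, 0 <= (v ^t* *m A *m v) 0 0.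

Definition npoint_Nevanlinna_Pick (R : realType) (X : Type) (H : rkhs R X)
    (K : X -> X -> R[i]) (n : nat) : Prop :=
  forall (z : 'I_n -> X) (l : 'I_n -> R[i]),
    psdmx (\matrix_(i, j) ((1 - l i * (l j)^*) * K (z i) (z j))) ->
    exists phi, [/\ Mult H phi, (mult_norm H phi <= 1%:E)%E
                  & forall i, phi (z i) = l i].

Definition Nevanlinna_Pick (R : realType) (X : Type) (H : rkhs R X)
    (K : X -> X -> R[i]) : Prop :=
  forall n, (1 <= n)%N -> npoint_Nevanlinna_Pick H K n.

Definition Mult_isometric (R : realType) (X : Type) (H1 H2 : rkhs R X) : Prop :=
  Mult H1 = Mult H2 /\
  (forall phi, Mult H1 phi -> mult_norm H1 phi = mult_norm H2 phi).

Definition Mult_completely_isometric (R : realType) (X : Type)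
    (H1 H2 : rkhs R X) : Prop :=
  Mult H1 = Mult H2 /\
  (forall (n : nat) (phi : 'M[X -> R[i]]_n),
     (forall i j, Mult H1 (phi i j)) ->
     mult_mx_norm H1 phi = mult_mx_norm H2 phi).

Definition rkhs_isometric (R : realType) (X : Type) (H1 H2 : rkhs R X) : Prop :=
  functions H1 = functions H2 /\
  (forall (f1 : H1) (f2 : H2), ev f1 = ev f2 -> hnorm f1 = hnorm f2).

(* Main.v *)
Require Import Defs.
From mathcomp Require Import all_boot all_order all_algebra sesquilinear.
From mathcomp Require Import complex.
From mathcomp Require Import all_classical all_reals all_analysis.
From mathcomp Require Import ring lra.

(** The substance is that the isometric multiplier algebra determines the
    kernel; an extremal two-point interpolation problem does it.

    Fix [z] and put [l = sqrt (1 - 1 / K1 z z)].  The Pick matrix of the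
    problem [x0 |-> 0], [z |-> l] is the all-ones matrix, so some contractive
    multiplier [phi] of [H1] solves it ([extremal_multiplier]).  Conversely, let
    [phi] be a contractive multiplier, of either space, with [phi x0 = 0] and
    [phi z = l]; let [K] be the kernel of that space, [a = K z z] and
    [k z = K (., z)].  Compare
    [phi * (l k z)] with [k z - k x0].  The reproducing property evaluates the
    inner product of the two, and expanding the squared norm of their difference
    bounds that squared norm by [a - 1 - l ^ 2 a] ([contractive_multiplier]).  This
    number is therefore nonnegative, and if it is zero the two functions agree:
    [(1 - phi w * l) * K w z = 1] for all [w], a formula that recovers [K (., z)]
    from [phi] and [l] alone.

    By hypothesis the [phi] obtained from [H1] is also contractive on [H2].  The
    inequality there says [K1 z z <= K2 z z]; by symmetry the diagonals agree, so
    equality holds in both spaces and the formula gives [K1 = K2]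
    ([kernel_of_isometric_mult]).

    Equal kernels force equal spaces because the kernel vectors span a dense
    subspace ([kernel_span_dense], through the orthogonal projection onto a
    subspace) on which both values and norms are expressed through [K]; limits are
    transferred by completeness ([rkhs_isometric_of_kernel]).  A bijection that
    preserves norms and function values preserves every operator norm in sight
    ([rkhs_isometric_completely]), the case of 1 x 1 matrices being the multiplier
    norm itself ([mult_mx_norm1]).  Finally the norm determines the kernel, because
    the squared distance between two representatives of evaluation at [y] is a
    difference of diagonal values ([rkhs_isometric_kernel]). *)

Set Implicit Arguments.
Unset Strict Implicit.
Unset Printing Implicit Defensive.

Import Order.TTheory GRing.Theory Num.Theory.
Import numFieldNormedType.Exports.

Local Open Scope classical_set_scope.
Local Open Scope ring_scope.
Local Open Scope complex_scope.

(** * Inner product, norm and evaluation *)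

Section RKHS.
Variables (R : realType) (X : Type) (H : rkhs R X).
Implicit Types (f g : H) (a : R[i]) (x : X).

Lemma evD f g x : ev (f + g) x = ev f x + ev g x.
Proof. by have := @ev_linear R X H x 1 f g; rewrite scale1r mul1r. Qed.

Lemma evZ a f x : ev (a *: f) x = a * ev f x.
Proof.
have ev0 : ev (0 : H) x = 0.
  by apply: (addrI (ev (0 : H) x)); rewrite addr0 -evD addr0.
by have := @ev_linear R X H x a f 0; rewrite addr0 ev0 addr0.
Qed.

Lemma ev0 x : ev (0 : H) x = 0.
Proof. by rewrite -(scale0r (0 : H)) evZ mul0r. Qed.

Lemma evB f g x : ev (f - g) x = ev f x - ev g x.
Proof. by rewrite evD -scaleN1r evZ mulN1r. Qed.

Lemma hnormE f : (hnorm f)%:C = `|f|.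
Proof. by rewrite RRe_real // ger0_real. Qed.

Lemma hnorm_ge0 f : 0 <= hnorm f.
Proof. by rewrite -lecR hnormE normr_ge0. Qed.

Lemma hnorm_eq0 f : hnorm f = 0 -> f = 0.
Proof. by move=> f0; apply/eqP; rewrite -normr_eq0 -hnormE f0. Qed.

Lemma hnorm_scale a f : hnorm (a *: f) = complex.Re `|a| * hnorm f.
Proof.
by apply: complexI; rewrite hnormE normrZ -hnormE normc_def -rmorphM.
Qed.

Lemma hnorm_opp f : hnorm (- f) = hnorm f.
Proof. by rewrite /hnorm normrN. Qed.

Lemma hnorm_triangle f g : hnorm (f + g) <= hnorm f + hnorm g.
Proof. by rewrite -lecR rmorphD /= !hnormE; exact: ler_normD. Qed.

Lemma sqr_hnorm f : hnorm f ^+ 2 = complex.Re (inner H f f).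
Proof. by rewrite -normE -hnormE -rmorphXn. Qed.

Lemma inner_hnorm f : inner H f f = (hnorm f ^+ 2)%:C.
Proof. by rewrite -normE -hnormE -rmorphXn. Qed.

Lemma innerC f g : inner H f g = (inner H g f)^*%C.
Proof. by rewrite hermC expr0 mul1r. Qed.

(** [linearBl] and its companions leave the form under another projection; these restatements keep it syntactically [inner H]. *)
Lemma innerBl f g h : inner H (f - g) h = inner H f h - inner H g h.
Proof. exact: linearBl. Qed.

Lemma innerBr f g h : inner H h (f - g) = inner H h f - inner H h g.
Proof. exact: linearBr. Qed.

Lemma innerZr a f g : inner H f (a *: g) = a^*%C * inner H f g.
Proof. exact: linearZr_LR. Qed.

Lemma inner_sumr (I : Type) (r : seq I) (F : I -> H) f :
  inner H f (\sum_(i <- r) F i) = \sum_(i <- r) inner H f (F i).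
Proof. exact: linear_sumr. Qed.

Lemma sqr_hnormB f g :
  hnorm (f - g) ^+ 2 = hnorm f ^+ 2 + hnorm g ^+ 2 - 2 * complex.Re (inner H f g).
Proof.
rewrite !sqr_hnorm innerBl !innerBr (innerC g f).
by case: (inner H f g) => p q /=; rewrite !raddfB /=; ring.
Qed.

End RKHS.

(** * Multipliers and the kernel *)

Section Multipliers.
Variables (R : realType) (X : Type) (H : rkhs R X).
Implicit Types (f g : H) (phi : X -> R[i]).

Lemma Mult_ev phi f : Mult H phi -> exists g : H, forall x, ev g x = phi x * ev f x.
Proof.
move=> Mphi; have [|g _ eg] := Mphi (ev f); first by exists f.
by exists g => x; rewrite eg.
Qed.

Lemma ev_mul_op phi f x : Mult H phi -> ev (mul_op phi f) x = phi x * ev f x.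
Proof.
move=> /(@Mult_ev _ f) /cid[g eg].
by rewrite /mul_op; case: xgetP => [h _ -> //|/(_ g)].
Qed.

Lemma mul_op_unique phi f g : (forall x, ev g x = phi x * ev f x) -> mul_op phi f = g.
Proof.
move=> eg; apply: (@ev_inj _ _ H); apply/funext => x.
by rewrite eg /mul_op; case: xgetP => [h _ -> //|/(_ g)].
Qed.

Lemma mul_opZ phi a f : Mult H phi -> mul_op phi (a *: f) = a *: mul_op phi f.
Proof.
by move=> Mphi; apply: mul_op_unique => x; rewrite !evZ ev_mul_op // mulrCA.
Qed.

(** The operator norm is a supremum over the unit ball, so homogeneity is what
    carries the bound to vectors of arbitrary norm. *)
Lemma mult_norm_contraction phi f :
  Mult H phi -> (mult_norm H phi <= 1%:E)%E -> hnorm (mul_op phi f) <= hnorm f.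
Proof.
move=> Mphi phi1; have [f0|f0] := eqVneq (hnorm f) 0.
  have -> : f = 0 by exact: hnorm_eq0.
  by rewrite -(scale0r (0 : H)) mul_opZ // !hnorm_scale normr0 !mul0r.
have fgt0 : 0 < hnorm f by rewrite lt_neqAle eq_sym f0 hnorm_ge0.
have nV : complex.Re `|((hnorm f)^-1)%:C| = (hnorm f)^-1.
  by rewrite ger0_norm // ler0c invr_ge0 hnorm_ge0.
have : ((hnorm (mul_op phi (((hnorm f)^-1)%:C *: f)))%:E <= 1%:E :> \bar R)%E.
  apply: le_trans phi1; apply: ereal_sup_ubound; exists (((hnorm f)^-1)%:C *: f) => //=.
  by rewrite hnorm_scale nV mulVf.
by rewrite mul_opZ // lee_fin hnorm_scale nV ler_pdivrMl // mulr1.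
Qed.

End Multipliers.

Section Kernel.
Variables (R : realType) (X : Type) (H : rkhs R X) (K : X -> X -> R[i]).
Hypothesis HK : reproducing_kernel H K.

Definition kvec (y : X) : H := projT1 (cid (HK y)).

Lemma ev_kvec x y : ev (kvec y) x = K x y.
Proof. by rewrite /kvec; case: cid => k []. Qed.

Lemma inner_kvec f y : inner H f (kvec y) = ev f y.
Proof. by rewrite /kvec; case: cid => k [] /= _ ->. Qed.

Lemma kernelC x y : K x y = (K y x)^*%C.
Proof. by rewrite -!ev_kvec -!inner_kvec innerC. Qed.

Lemma sqr_hnorm_kvec x : hnorm (kvec x) ^+ 2 = complex.Re (K x x).
Proof. by rewrite sqr_hnorm inner_kvec ev_kvec. Qed.

Lemma kernel_diag x : K x x = (complex.Re (K x x))%:C.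
Proof. by rewrite -sqr_hnorm_kvec -inner_hnorm inner_kvec ev_kvec. Qed.

Variable x0 : X.
Hypothesis K0 : normalized K x0.

Lemma sqr_hnorm_kvecB z : hnorm (kvec z - kvec x0) ^+ 2 = complex.Re (K z z) - 1.
Proof.
rewrite sqr_hnormB !sqr_hnorm_kvec inner_kvec ev_kvec (kernelC x0 z) !K0 /=.
ring.
Qed.

Lemma normalized_diag_ge1 z : 1 <= complex.Re (K z z).
Proof. by rewrite -subr_ge0 -sqr_hnorm_kvecB sqr_ge0. Qed.

(** The value at [z] is the largest that a contractive multiplier vanishing at
    [x0] can take: it makes the Pick matrix of the two points equal to the
    all-ones matrix, which is singular. *)
Lemma extremal_multiplier z : Nevanlinna_Pick H K ->
  exists phi, [/\ Mult H phi, (mult_norm H phi <= 1%:E)%E, phi x0 = 0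
    & phi z = (Num.sqrt (1 - (complex.Re (K z z))^-1))%:C].
Proof.
set a := complex.Re (K z z); set l := Num.sqrt _ => NP.
have a1 : 1 <= a by exact: normalized_diag_ge1.
have a0 : 0 < a by exact: lt_le_trans a1.
have l2 : (1 - l ^+ 2) * a = 1.
  by rewrite sqr_sqrtr ?subr_ge0 ?invf_le1 // subKr mulVf // gt_eqF.
have [||phi [Mphi phi1 phiE]] := NP 2%N _ (fun i => if i == 0 then x0 else z)
    (fun i => if i == 0 then 0 else l%:C); [by []| |].
  move=> v.
  set A := (X in _ *m X *m _).
  have -> : A = const_mx 1.
    apply/matrixP => i j; rewrite !mxE.
    case: (i == 0); case: (j == 0).
    - by rewrite mul0r subr0 K0 mulr1.
    - by rewrite mul0r subr0 kernelC K0 conjc1 mulr1.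
    - by rewrite rmorph0 mulr0 subr0 K0 mulr1.
    - rewrite [Num.conj _]conjc_real kernel_diag -rmorphM -expr2.
      by rewrite -(rmorph1 (real_complex R)) -rmorphB -rmorphM l2.
  (* The form of the all-ones matrix is [|v 0 + v 1| ^ 2]. *)
  rewrite !mxE !big_ord_recl !big_ord0 !mxE !big_ord_recl !big_ord0 !mxE.
  rewrite !addr0 !mulr1 -mulrDr -rmorphD mulrC.
  exact: mul_conjC_ge0.
exists phi; split => //; first exact: (phiE 0).
exact: (phiE 1).
Qed.

(** The adjoint of multiplication by [phi] sends [kvec y] to
    [(phi y)^* *: kvec y], hence [v := kvec z - kvec x0] to [g := l *: kvec z].
    Contractivity of the adjoint on [v] is the inequality; if equality holds, then
    [phi * g = v], as for every vector on which an adjoint contraction is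
    isometric.  Estimating [phi * g - v] directly avoids constructing the
    adjoint. *)
Lemma contractive_multiplier phi z (l : R) :
  Mult H phi -> (mult_norm H phi <= 1%:E)%E -> phi x0 = 0 -> phi z = l%:C ->
  l ^+ 2 * complex.Re (K z z) <= complex.Re (K z z) - 1 /\
  (l ^+ 2 * complex.Re (K z z) = complex.Re (K z z) - 1 ->
   forall w, (1 - phi w * l%:C) * K w z = 1).
Proof.
move=> Mphi phi1 phi0 phiz.
pose g := l%:C *: kvec z; pose v := kvec z - kvec x0; pose w := mul_op phi g.
have wv : hnorm (w - v) ^+ 2 <=
    complex.Re (K z z) - 1 - l ^+ 2 * complex.Re (K z z).
  have g2 : hnorm g ^+ 2 = l ^+ 2 * complex.Re (K z z).
    by rewrite hnorm_scale exprMn sqr_hnorm_kvec normc_def /= expr0n addr0 sqrtr_sqr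
               real_normK // num_real.
  have -> : hnorm (w - v) ^+ 2 = hnorm w ^+ 2 + (complex.Re (K z z) - 1)
      - 2 * (l ^+ 2 * complex.Re (K z z)).
    rewrite sqr_hnormB sqr_hnorm_kvecB innerBr !inner_kvec !ev_mul_op // phi0 phiz.
    rewrite mul0r subr0 evZ ev_kvec kernel_diag -!rmorphM /=.
    by rewrite mulrA -expr2.
  have : hnorm w ^+ 2 <= hnorm g ^+ 2.
    by rewrite ler_sqr ?nnegrE ?hnorm_ge0 //; exact: mult_norm_contraction.
  rewrite g2; lra.
split; first by have := sqr_ge0 (hnorm (w - v)); lra.
move=> l2 y; have wv0 : w - v = 0.
  apply: hnorm_eq0; apply/eqP; rewrite -sqrf_eq0 eq_le sqr_ge0 andbT.
  by rewrite (le_trans wv) // l2 subrr.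
have : ev (w - v) y = 0 by rewrite wv0 ev0.
rewrite !evB ev_mul_op // evZ !ev_kvec K0 => /eqP; rewrite subr_eq0 => /eqP E.
by rewrite mulrBl mul1r -mulrA E subKr.
Qed.

End Kernel.

(** The extremal multiplier of [H1] at [z] is contractive on [H2], which compares
    the diagonals; once these agree, it is extremal in both spaces and determines
    both kernels by the same formula. *)
Lemma kernel_of_isometric_mult (R : realType) (X : Type) (H1 H2 : rkhs R X)
    (K1 K2 : X -> X -> R[i]) (x0 : X) :
  reproducing_kernel H1 K1 -> reproducing_kernel H2 K2 ->
  Nevanlinna_Pick H1 K1 -> Nevanlinna_Pick H2 K2 ->
  normalized K1 x0 -> normalized K2 x0 -> Mult_isometric H1 H2 -> K1 = K2.
Proof.
move=> HK1 HK2 NP1 NP2 N1 N2 [eM eN].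
have diag_le (G1 G2 : rkhs R X) (L1 L2 : X -> X -> R[i]) z :
    reproducing_kernel G1 L1 -> reproducing_kernel G2 L2 ->
    normalized L1 x0 -> normalized L2 x0 ->
    Nevanlinna_Pick G1 L1 -> Mult_isometric G1 G2 ->
    complex.Re (L1 z z) <= complex.Re (L2 z z).
  move=> GL1 GL2 M1 M2 NP [eM' eN'].
  have a1 := normalized_diag_ge1 GL1 M1 z.
  have a0 : 0 < complex.Re (L1 z z) by exact: lt_le_trans a1.
  have [phi [Mphi phi1 p0 pz]] := extremal_multiplier GL1 M1 z NP.
  rewrite eN' // in phi1; rewrite eM' in Mphi.
  have [+ _] := contractive_multiplier GL2 M2 Mphi phi1 p0 pz.
  rewrite sqr_sqrtr ?subr_ge0 ?invf_le1 // mulrBl mul1r lerD2l lerN2.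
  by rewrite mulrC ler_pdivlMr // mul1r.
have diag z : complex.Re (K1 z z) = complex.Re (K2 z z).
  apply/eqP; rewrite eq_le (diag_le H1 H2) ?(diag_le H2 H1) //.
  by split; [rewrite eM|move=> phi; rewrite -eM => /eN].
apply/funext => w; apply/funext => z.
have a1 := normalized_diag_ge1 HK1 N1 z.
have a0 : 0 < complex.Re (K1 z z) by exact: lt_le_trans a1.
have [phi [Mphi phi1 p0 pz]] := extremal_multiplier HK1 N1 z NP1.
have [_ E1] := contractive_multiplier HK1 N1 Mphi phi1 p0 pz.
move: Mphi phi1; move=> /[dup] /eN -> ; rewrite eM => Mphi phi1.
have [_ E2] := contractive_multiplier HK2 N2 Mphi phi1 p0 pz.
have l2 : Num.sqrt (1 - (complex.Re (K1 z z))^-1) ^+ 2 * complex.Re (K1 z z)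
    = complex.Re (K1 z z) - 1.
  by rewrite sqr_sqrtr ?subr_ge0 ?invf_le1 // mulrBl mul1r mulVf // gt_eqF.
have {}E1 := E1 l2 w.
rewrite -diag in E2; have {}E2 := E2 l2 w.
set c := (X in X * _) in E1 E2.
have c0 : c != 0 by apply/eqP => c0; move/eqP: E1; rewrite c0 mul0r eq_sym oner_eq0.
by apply: (mulfI c0); rewrite E1 E2.
Qed.

(** * Completeness and orthogonal projection *)

Section Hilbert.
Variables (R : realType) (X : Type) (H : rkhs R X).
Implicit Types (f g p : H) (u : nat -> H).

(** Convergence in [H] is measured by radii in [R[i]]; this restates it with real
    ones, for which real arithmetic is available. *)
Lemma cvg_hnormP u p :
  u @ \oo --> p <-> forall e : R, 0 < e -> \forall n \near \oo, hnorm (p - u n) < e.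
Proof.
split=> [/cvgrPdist_lt up e e0|up].
  have e0C : 0 < e%:C :> R[i] by rewrite ltcR.
  by have := up _ e0C; apply: filterS => n; rewrite -hnormE ltcR.
apply/cvgrPdist_lt => e e0.
have eC : e = (complex.Re e)%:C by rewrite RRe_real ?gtr0_real.
have /up : 0 < complex.Re e by rewrite -ltcR -eC.
by apply: filterS => n; rewrite -hnormE {2}eC ltcR.
Qed.

Lemma cvg_of_hnorm_cauchy u :
  (forall e : R, 0 < e -> exists N, forall n, (N <= n)%N -> hnorm (u N - u n) < e) ->
  exists p, u @ \oo --> p.
Proof.
move=> uC; suff : cvg (u @ \oo) by exists (lim (u @ \oo)).
apply/cauchy_cvgP/cauchy_exP => e e0.
have eC : e = (complex.Re e)%:C by rewrite RRe_real ?gtr0_real.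
have [|N NE] := uC (complex.Re e); first by rewrite -ltcR -eC.
exists (u N); exists N => // n /= Nn; rewrite -ball_normE /= -hnormE eC ltcR.
exact: NE.
Qed.

Lemma cvg_ev u p x : u @ \oo --> p -> (fun n => ev (u n) x) @ \oo --> (ev p x : R[i]^o).
Proof.
move=> up; apply: (@cvg_comp _ _ _ u (fun f => ev f x : R[i]^o) _ _ _ up).
exact: ev_continuous.
Qed.

Lemma parallelogram f g :
  hnorm (f + g) ^+ 2 + hnorm (f - g) ^+ 2 = 2 * hnorm f ^+ 2 + 2 * hnorm g ^+ 2.
Proof.
have -> : f + g = f - (-1) *: g by rewrite scaleN1r opprK.
rewrite !sqr_hnormB innerZr scaleN1r hnorm_opp rmorphN1 mulN1r raddfN /=; ring.
Qed.

(** Moving from [f] towards [g] by a small positive multiple of [inner H f g]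
    would shorten [f] to first order. *)
Lemma orthogonal_of_minimal f g :
  (forall a : R[i], hnorm f <= hnorm (f - a *: g)) -> inner H f g = 0.
Proof.
move=> fmin; set c := inner H f g.
pose C := complex.Re c ^+ 2 + complex.Im c ^+ 2; pose G := hnorm g ^+ 2.
have G1 : 0 < G + 1 by rewrite ltr_wpDl ?sqr_ge0.
(* Any [t] in the open interval from 0 to [2 / G] works; the [+ 1] covers
   [G = 0]. *)
pose t := (G + 1)^-1.
have t0 : 0 < t by rewrite invr_gt0.
have tG : t * G + t = 1 by rewrite -{2}[t]mulr1 -mulrDr mulVf ?gt_eqF.
have := fmin (t%:C * c); rewrite -ler_sqr ?nnegrE ?hnorm_ge0 //.
have -> : hnorm (f - (t%:C * c) *: g) ^+ 2 =
    hnorm f ^+ 2 + t ^+ 2 * C * G - 2 * (t * C).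
  rewrite sqr_hnormB hnorm_scale exprMn innerZr -/c -/G normc_def [complex.Re _%:C]/=.
  rewrite sqr_sqrtr ?addr_ge0 ?sqr_ge0 // /C; case: (c) => x y /=; ring.
rewrite -addrA lerDl => tC.
have C0 : C <= 0.
  rewrite -(pmulr_rle0 _ t0) -(ler_pM2l t0) mulr0.
  move: tC; nra.
have : C == 0 by rewrite eq_le C0 addr_ge0 ?sqr_ge0.
by rewrite paddr_eq0 ?sqr_ge0 // !sqrf_eq0 => /andP[/eqP r0 /eqP i0];
  rewrite [c]complexE r0 i0 mulr0 addr0.
Qed.

(** The subspace [S] need not be closed, so the projection [p] is given as the
    limit of a sequence in [S].  Minimizing sequences are Cauchy because the
    midpoint of two of their terms lies in [S] too. *)
Lemma orthogonal_projection (S : set H) f :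
  S 0 -> (forall g h, S g -> S h -> S (g + h)) -> (forall a g, S g -> S (a *: g)) ->
  exists u, (forall n, S (u n)) /\
    exists2 p, u @ \oo --> p & forall g, S g -> inner H (f - p) g = 0.
Proof.
move=> S0 SD SZ; pose D := [set hnorm (f - s) ^+ 2 | s in S]; pose d := inf D.
have Dlb : lbound D 0 by move=> _ [s _ <-]; exact: sqr_ge0.
have Dinf : has_inf D by split; [exists (hnorm (f - 0) ^+ 2), 0 | exists 0].
have dle s : S s -> d <= hnorm (f - s) ^+ 2.
  by move=> Ss; apply: ge_inf; [exists 0|exists s].
have /choice[u uP] : forall n, exists s, S s /\ hnorm (f - s) ^+ 2 < d + n.+1%:R^-1.
  move=> n; have n0 : 0 < n.+1%:R^-1 :> R by rewrite invr_gt0.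
  by have [_ [s Ss <-] sd] := inf_adherent n0 Dinf; exists s.
have uS n : S (u n) by exact: (uP n).1.
exists u; split => //.
have uC m n : hnorm (u m - u n) ^+ 2 <= 2 * m.+1%:R^-1 + 2 * n.+1%:R^-1.
  have := parallelogram (f - u m) (f - u n).
  have -> : f - u m + (f - u n) = 2%:C *: (f - (2^-1)%:C *: (u m + u n)).
    rewrite scalerBr scalerA -rmorphM mulfV // scale1r opprD addrACA.
    by rewrite rmorph_nat scaler_nat mulr2n.
  have -> : f - u m - (f - u n) = - (u m - u n) by rewrite !opprB addrC addrA subrK.
  rewrite hnorm_opp hnorm_scale exprMn normc_def.
  rewrite [complex.Re _%:C]/= expr0n addr0 sqrtr_sqr ger0_norm //.
  have := dle ((2^-1)%:C *: (u m + u n)) (SZ _ _ (SD _ _ (uS m) (uS n))).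
  have := (uP m).2; have := (uP n).2.
  move: (n.+1%:R^-1) (m.+1%:R^-1) => x y; lra.
have [e e0|p up] := @cvg_of_hnorm_cauchy u.
  have d0 : 0 < e ^+ 2 / 4 by rewrite divr_gt0 ?exprn_gt0.
  have [N _ NE] : \forall n \near \oo, n.+1%:R^-1 < e ^+ 2 / 4.
    exact: (near_infty_natSinv_lt (PosNum d0)).
  exists N => n Nn; rewrite -ltr_sqr ?nnegrE ?hnorm_ge0 ?(ltW e0) //.
  apply: (le_lt_trans (uC N n)).
  have /= := NE N (leqnn N); have /= := NE n Nn.
  by move: (N.+1%:R^-1) (n.+1%:R^-1) (e ^+ 2) => x y z; lra.
exists p => // g Sg; apply: orthogonal_of_minimal => a.
(* Both [f - p] and [f - p - a *: g] are limits of vectors [f - s] with [s] in [S],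
   and the lengths of those that converge to [f - p] tend to the infimum. *)
apply/ler_addgt0Pr => e e0; have e3 : 0 < e / 3 by rewrite divr_gt0.
have d0 : 0 <= d by apply: lb_le_inf => //; exact: Dinf.1.
have [n [pn nE]] : exists n, hnorm (p - u n) < e / 3 /\ n.+1%:R^-1 < (e / 3) ^+ 2.
  have e32 : 0 < (e / 3) ^+ 2 by rewrite exprn_gt0.
  move/cvg_hnormP/(_ _ e3) : up => up.
  have [N _ NE] := filterI up (near_infty_natSinv_lt (PosNum e32)).
  by exists N; apply: (NE N); rewrite /=.
have fu : hnorm (f - u n) < Num.sqrt d + e / 3.
  rewrite -ltr_sqr ?nnegrE ?hnorm_ge0 ?addr_ge0 ?sqrtr_ge0 ?(ltW e3) //.
  apply: (lt_trans (uP n).2); rewrite sqrrD sqr_sqrtr // -addrA ltrD2l.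
  by rewrite (lt_le_trans nE) // lerDr mulrn_wge0 // mulr_ge0 ?sqrtr_ge0 // ltW.
have fag : Num.sqrt d <= hnorm (f - (u n + a *: g)).
  rewrite -ler_sqr ?nnegrE ?hnorm_ge0 ?sqrtr_ge0 // sqr_sqrtr //.
  by apply/dle/SD => //; exact: SZ.
have := hnorm_triangle (f - u n) (u n - p); rewrite addrA subrK.
have := hnorm_triangle (f - p - a *: g) (p - u n).
have -> : f - p - a *: g + (p - u n) = f - (u n + a *: g).
  by rewrite addrAC addrA subrK opprD addrA.
rewrite -[hnorm (u n - p)]hnorm_opp opprB; move: pn fu fag; lra.
Qed.

End Hilbert.

Section Limits.
Variables (R : realType) (X : Type) (H1 H2 : rkhs R X).
Variables (u : nat -> H1) (v : nat -> H2) (f : H1) (g : H2).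
Hypotheses (uf : u @ \oo --> f) (vg : v @ \oo --> g).

Lemma ev_lim_eq : (forall n, ev (u n) = ev (v n)) -> ev f = ev g.
Proof.
move=> uv; apply/funext => x; have uf' := cvg_ev (x := x) uf.
have E : (fun n => ev (u n) x) = (fun n => ev (v n) x) by apply/funext => n; rewrite uv.
rewrite E in uf'.
exact: (cvg_unique (@norm_hausdorff _ R[i]^o) uf' (cvg_ev (x := x) vg)).
Qed.

Lemma hnorm_lim_eq : (forall n, hnorm (u n) = hnorm (v n)) -> hnorm f = hnorm g.
Proof.
move=> uv; have uf' : (fun n => `|u n| : R[i]^o) @ \oo --> (`|f| : R[i]^o).
  exact: cvg_norm.
have vg' : (fun n => `|v n| : R[i]^o) @ \oo --> (`|g| : R[i]^o).
  exact: cvg_norm.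
have E : (fun n => `|u n| : R[i]^o) = (fun n => `|v n| : R[i]^o)
  by apply/funext => n; rewrite -!hnormE uv.
rewrite E in uf'; apply: complexI; rewrite !hnormE.
exact: (cvg_unique (@norm_hausdorff _ R[i]^o) uf' vg').
Qed.

End Limits.

(** * The span of the kernel *)

Section KernelSpan.
Variables (R : realType) (X : Type) (H : rkhs R X) (K : X -> X -> R[i]).
Hypothesis HK : reproducing_kernel H K.
Implicit Types s t : seq (R[i] * X).

(** Combinations are indexed by formal lists of coefficients and points, so that
    the same index makes sense in every space having kernel [K]. *)
Definition kernel_comb s : H := \sum_(p <- s) p.1 *: kvec HK p.2.

Definition scale_coef (a : R[i]) s := [seq (a * p.1, p.2) | p <- s].

Lemma kernel_combD s t : kernel_comb (s ++ t) = kernel_comb s + kernel_comb t.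
Proof. by rewrite /kernel_comb big_cat. Qed.

Lemma kernel_combZ a s : kernel_comb (scale_coef a s) = a *: kernel_comb s.
Proof.
rewrite /kernel_comb big_map scaler_sumr.
by apply: eq_bigr => p _; rewrite scalerA.
Qed.

Lemma kernel_combB s t :
  kernel_comb s - kernel_comb t = kernel_comb (s ++ scale_coef (-1) t).
Proof. by rewrite kernel_combD kernel_combZ scaleN1r. Qed.

Lemma ev_kernel_comb s x : ev (kernel_comb s) x = \sum_(p <- s) p.1 * K x p.2.
Proof.
rewrite /kernel_comb; elim: s => [|p s IH]; first by rewrite !big_nil ev0.
by rewrite !big_cons evD evZ ev_kvec IH.
Qed.

(** Written through [K] so that the norm can be compared between different spaces
    having this kernel. *)
Lemma sqr_hnorm_kernel_comb s : hnorm (kernel_comb s) ^+ 2 =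
  complex.Re (\sum_(p <- s) p.1^*%C * \sum_(q <- s) q.1 * K p.2 q.2).
Proof.
rewrite sqr_hnorm {2}/kernel_comb inner_sumr; congr complex.Re.
by apply: eq_bigr => p _; rewrite innerZr inner_kvec ev_kernel_comb.
Qed.

(** A vector orthogonal to all [kvec x] is the zero function, hence zero by
    injectivity of [ev]; apply this to [f] minus its projection. *)
Lemma kernel_span_dense (f : H) : exists c : nat -> seq (R[i] * X),
  (fun n => kernel_comb (c n)) @ \oo --> f.
Proof.
have [|g h [s _ <-] [t _ <-]|a g [s _ <-]|u [uS [p up pf]]] :=
    @orthogonal_projection _ _ H (range kernel_comb) f.
- by exists [::] => //; rewrite /kernel_comb big_nil.
- by exists (s ++ t) => //; rewrite kernel_combD.
- by exists (scale_coef a s) => //; rewrite kernel_combZ.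
- have /choice[c cu] : forall n, exists s, kernel_comb s = u n.
    by move=> n; have [s _ <-] := uS n; exists s.
  exists c; have -> : (fun n => kernel_comb (c n)) = u by apply/funext.
  suff -> : f = p by [].
  apply: (@ev_inj _ _ H); apply/funext => x; apply/eqP; rewrite -subr_eq0 -evB.
  rewrite -(inner_kvec HK) pf //; exists [:: (1, x)] => //.
  by rewrite /kernel_comb big_seq1 scale1r.
Qed.

End KernelSpan.

(** Approximate [f] by kernel combinations in the first space.  The same formal
    combinations form a Cauchy sequence in the second, with the same norms and the
    same values, hence with a limit having the norm and the values of [f]. *)
Lemma rkhs_isometric_of_kernel (R : realType) (X : Type) (H1 H2 : rkhs R X)
    (K : X -> X -> R[i]) :
  reproducing_kernel H1 K -> reproducing_kernel H2 K -> rkhs_isometric H1 H2.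
Proof.
have transfer (G1 G2 : rkhs R X) (GK1 : reproducing_kernel G1 K)
    (GK2 : reproducing_kernel G2 K) (f : G1) :
    exists2 g : G2, ev g = ev f & hnorm g = hnorm f.
  have [c cf] := kernel_span_dense GK1 f.
  have norm_comb s : hnorm (kernel_comb GK1 s) = hnorm (kernel_comb GK2 s).
    by apply/eqP; rewrite -(@eqrXn2 _ 2) ?hnorm_ge0 // !sqr_hnorm_kernel_comb.
  have norm_combB s t : hnorm (kernel_comb GK1 s - kernel_comb GK1 t) =
      hnorm (kernel_comb GK2 s - kernel_comb GK2 t).
    by rewrite !kernel_combB norm_comb.
  have [e e0|g cg] := @cvg_of_hnorm_cauchy _ _ G2 (fun n => kernel_comb GK2 (c n)).
    have e2 : 0 < e / 2 by rewrite divr_gt0.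
    have [N _ NE] := (cvg_hnormP _ _).1 cf _ e2.
    exists N => n Nn; rewrite -norm_combB.
    have := hnorm_triangle (kernel_comb GK1 (c N) - f) (f - kernel_comb GK1 (c n)).
    rewrite addrA subrK -(hnorm_opp (_ - f)) opprB.
    have /= := NE N (leqnn N); have /= := NE n Nn; lra.
  exists g.
    apply/esym/(ev_lim_eq cf cg) => n; apply/funext => x.
    by rewrite !ev_kernel_comb.
  exact/esym/(hnorm_lim_eq cf cg).
move=> HK1 HK2; split.
  apply/seteqP; split=> _ [f _ <-].
    by have [g eg _] := transfer _ _ HK1 HK2 f; exists g.
  by have [g eg _] := transfer _ _ HK2 HK1 f; exists g.
move=> f1 f2 e; have [g eg <-] := transfer _ _ HK1 HK2 f1.
by congr hnorm; apply: (@ev_inj _ _ H2); rewrite eg.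
Qed.

(** * Isometric spaces *)

Lemma op_norm_transport (R : realType) (V W : Type) (N : V -> R) (M : W -> R)
    (S : V -> V) (T : W -> W) (U : V -> W) :
  (forall w, exists v, U v = w) -> (forall v, M (U v) = N v) ->
  (forall v, M (T (U v)) = N (S v)) -> op_norm N S = op_norm M T.
Proof.
move=> Usurj MU MTU; rewrite /op_norm; congr ereal_sup.
apply/seteqP; split=> _ [v /= v1 <-].
  by exists (U v); rewrite /= ?MU ?MTU.
by have [u uv] := Usurj v; exists u; [rewrite /= -MU uv|rewrite -MTU uv].
Qed.

Lemma mult_mx_norm1 (R : realType) (X : Type) (H : rkhs R X) (phi : X -> R[i]) :
  mult_norm H phi = @mult_mx_norm R X H 1 (const_mx phi).
Proof.
have sum1 (f : H) : hnorm_sum (fun _ : 'I_1 => f) = hnorm f.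
  by rewrite /hnorm_sum big_ord1 sqrtr_sqr ger0_norm // hnorm_ge0.
apply: (@op_norm_transport _ _ _ _ _ _ _ (fun f => fun _ : 'I_1 => f)) => f //.
  by exists (f 0); apply/funext => i; rewrite ord1.
rewrite -sum1; congr hnorm_sum; apply/funext => i.
by rewrite /mul_op_mx big_ord1 mxE.
Qed.

Lemma Mult_isometric_of_completely (R : realType) (X : Type) (H1 H2 : rkhs R X) :
  Mult_completely_isometric H1 H2 -> Mult_isometric H1 H2.
Proof.
move=> [eM eN]; split=> // phi Mphi; rewrite !mult_mx_norm1 eN // => i j.
by rewrite mxE.
Qed.

Lemma rkhs_isometric_sym (R : realType) (X : Type) (H1 H2 : rkhs R X) :
  rkhs_isometric H1 H2 -> rkhs_isometric H2 H1.
Proof. by move=> [eF eN]; split=> // f2 f1 /esym/eN. Qed.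

Lemma rkhs_isometric_transfer (R : realType) (X : Type) (H1 H2 : rkhs R X) (f : H1) :
  rkhs_isometric H1 H2 -> exists2 g : H2, ev g = ev f & hnorm g = hnorm f.
Proof.
move=> [eF eN]; have : functions H2 (ev f) by rewrite -eF; exists f.
by move=> [g _ eg]; exists g => //; apply/esym/eN.
Qed.

(** The map sending a vector of [H1] to the vector of [H2] with the same values is
    additive and intertwines the multiplication operators, so it identifies their
    matrices entrywise. *)
Lemma rkhs_isometric_completely (R : realType) (X : Type) (H1 H2 : rkhs R X) :
  rkhs_isometric H1 H2 -> Mult_completely_isometric H1 H2.
Proof.
move=> iso; have eM : Mult H1 = Mult H2 by rewrite /Mult (proj1 iso).
split=> // n phi Mphi.
have /choice[U eU] : forall f : H1, exists g : H2, ev g = ev f /\ hnorm g = hnorm f.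
  by move=> f; have [g] := rkhs_isometric_transfer f iso; exists g.
have U0 : U 0 = 0.
  by apply: (@ev_inj _ _ H2); rewrite (eU _).1; apply/funext => x; rewrite !ev0.
have UD f g : U (f + g) = U f + U g.
  by apply: (@ev_inj _ _ H2); rewrite (eU _).1; apply/funext => x;
    rewrite !evD !(eU _).1.
apply: (@op_norm_transport _ _ _ _ _ _ _ (fun f i => U (f i))) => [w|v|v].
- have /choice[V eV] : forall i, exists g : H1, ev g = ev (w i).
    move=> i; have [g] := rkhs_isometric_transfer (w i) (rkhs_isometric_sym iso).
    by exists g.
  by exists V; apply/funext => i; apply: (@ev_inj _ _ H2); rewrite (eU _).1.
- by rewrite /hnorm_sum; under eq_bigr do rewrite (eU _).2.
- rewrite /hnorm_sum; congr Num.sqrt; apply: eq_bigr => i _.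
  rewrite -(eU (mul_op_mx _ _ _)).2 /mul_op_mx (big_morph U UD U0).
  congr (hnorm _ ^+ 2); apply: eq_bigr => j _.
  apply: mul_op_unique => x; rewrite !(eU _).1 ev_mul_op //.
Qed.

(** Let [g] be the copy in the second space of the first kernel vector at [y].  Its
    squared distance to the second kernel vector is [K2 y y - K1 y y], because the
    cross term is the evaluation of [g] at [y].  The roles can be exchanged, so both
    this number and its opposite are nonnegative. *)
Lemma rkhs_isometric_kernel (R : realType) (X : Type) (H1 H2 : rkhs R X)
    (K1 K2 : X -> X -> R[i]) :
  reproducing_kernel H1 K1 -> reproducing_kernel H2 K2 ->
  rkhs_isometric H1 H2 -> K1 = K2.
Proof.
have gap (G1 G2 : rkhs R X) (L1 L2 : X -> X -> R[i]) (GL1 : reproducing_kernel G1 L1)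
    (GL2 : reproducing_kernel G2 L2) y : rkhs_isometric G1 G2 ->
    exists2 g : G2, ev g = ev (kvec GL1 y) &
      hnorm (g - kvec GL2 y) ^+ 2 = complex.Re (L2 y y) - complex.Re (L1 y y).
  move=> /(rkhs_isometric_transfer (kvec GL1 y))[g eg ng]; exists g => //.
  rewrite sqr_hnormB ng !sqr_hnorm_kvec inner_kvec eg ev_kvec; ring.
move=> HK1 HK2 iso; apply/funext => x; apply/funext => y.
have [g eg ng] := gap _ _ _ _ HK1 HK2 y iso.
have [h _ nh] := gap _ _ _ _ HK2 HK1 y (rkhs_isometric_sym iso).
have /hnorm_eq0/eqP : hnorm (g - kvec HK2 y) = 0.
  apply/eqP; rewrite -sqrf_eq0 eq_le sqr_ge0 andbT.
  by have := sqr_ge0 (hnorm (h - kvec HK1 y)); lra.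
by rewrite subr_eq0 => /eqP gk; rewrite -(ev_kvec HK1) -(ev_kvec HK2) -eg gk.
Qed.

(** * The equivalence *)

Theorem corollary3p2 (R : realType) (X : Type) (H1 H2 : rkhs R X)
    (K1 K2 : X -> X -> complex R) (x0 : X) :
  reproducing_kernel H1 K1 -> reproducing_kernel H2 K2 ->
  irreducible K1 -> irreducible K2 ->
  Nevanlinna_Pick H1 K1 -> Nevanlinna_Pick H2 K2 ->
  normalized K1 x0 -> normalized K2 x0 ->
  [<-> Mult_isometric H1 H2;
       Mult_completely_isometric H1 H2;
       rkhs_isometric H1 H2;
       K1 = K2].
Proof.
move=> HK1 HK2 _ _ NP1 NP2 N1 N2.
have iso : Mult_isometric H1 H2 -> rkhs_isometric H1 H2.
  move=> /(kernel_of_isometric_mult HK1 HK2 NP1 NP2 N1 N2) eK; subst K2.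
  exact: rkhs_isometric_of_kernel HK1 HK2.
tfae.
- by move=> /iso/rkhs_isometric_completely.
- by move=> /Mult_isometric_of_completely/iso.
- exact: rkhs_isometric_kernel.
- move=> eK; subst K2; apply/Mult_isometric_of_completely/rkhs_isometric_completely.
  exact: rkhs_isometric_of_kernel HK1 HK2.
Qed.
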